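(* Let $\mathbf{C}$ be a category and $W$ a class of arrows of $\mathbf{C}$ satisfying the conditions CF1, CF2, CF3. Then the double category $\mathbf{C}\{W\}$ is weakly globular.
   Context: Conditions on $W$: CF1: $W$ contains all isomorphisms and is closed under composition. CF2: for $f\colon C\to B$ and $w\colon A\to B$ with $w\in W$ there are $\bar f\colon D\to A$ and $\bar w\colon D\to C$ with $\bar w\in W$ and $w\bar f=f\bar w$. CF3: if $w\in W$ and $wf=wg$ there is $\tilde w\in W$ with $f\tilde w=g\tilde w$. A double category $\mathbb{X}$ is an internal category in $\mathbf{Cat}$: $\mathbb{X}_0$ is the category of objects and vertical arrows, $\mathbb{X}_1$ the category of horizontal arrows and double cells (with vertical composition). It is *weakly globular* if (i) there is an equivalence of categories $\gamma\colon\mathbb{X}_0\to\mathbb{X}_0^d$, where $\mathbb{X}_0^d$ is the discrete category of connected components of $\mathbb{X}_0$, and (ii) for all $n\ge2$ the functor induced by $\gamma$ from the $n$-fold $\mathbb{X}_1\times_{\mathbb{X}_0}\cdots\times_{\mathbb{X}_0}\mathbb{X}_1$ to the $n$-fold $\mathbb{X}_1\times_{\mathbb{X}_0^d}\cdots\times_{\mathbb{X}_0^d}\mathbb{X}_1$ is an equivalence of categories. The double category $\mathbf{C}\{W\}$: - Objects: arrows $w\colon A\to B$ in $W$, written $(w)$. - Vertical arrows $(w_1\colon A_1\to B)\to(w_2\colon A_2\to B)$ (same codomain $B$): equivalence classes $[u_1,C,u_2]$ of pairs $u_1\colon C\to A_1$, $u_2\colon C\to A_2$ in $\mathbf{C}$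 with $w_1u_1=w_2u_2\in W$; $(u_1,C,u_2)\sim(v_1,D,v_2)$ if there are $r_1\colon E\to C$, $r_2\colon E\to D$ with $u_1r_1=v_1r_2$, $u_2r_1=v_2r_2$ and $w_1u_1r_1\in W$. - Horizontal arrows $(w\colon A\to B)\to(w'\colon A'\to B')$: arrows $f\colon A\to A'$ of $\mathbf{C}$, composed as in $\mathbf{C}$. - Double cells with top $f_1\colon(w_1)\to(w_1')$, bottom $f_2\colon(w_2)\to(w_2')$, left side $[u_1,C,u_2]$ and right side $[u_1',C',u_2']$: equivalence classes of arrows $\varphi\colon C\to C'$, for representatives of the sides, with $f_1u_1=u_1'\varphi$ and $f_2u_2=u_2'\varphi$. Such $\varphi$ and $\psi\colon D\to D'$ (for representatives $(v_1,D,v_2)$, $(v_1',D',v_2')$) are equivalent if there are $r\colon E\to C$, $s\colon E\to D$, $r'\colon E'\to C'$, $s'\colon E'\to D'$, $\chi\colon E\to E'$ with $\varphi r=r'\chi$, $\psi s=s'\chi$, $u_ir=v_is$, $u_i'r'=v_i's'$ ($i=1,2$), $w_1u_1r\in W$ and $w_1'u_1'r'\in W$. - Vertical composition: for $[u_1,C,u_2]\colon(w_1)\to(w_2)$ and $[v_1,D,v_2]\colon(w_2)\to(w_3)$ choose $\bar v_1\colon E\to C$, $\bar u_2\colon E\to D$ with $u_2\bar v_1=v_1\bar u_2$ and $w_2u_2\bar v_1\in W$; the composite is $[u_1\bar v_1,E,v_2\bar u_2]$. For double cells represented by $\varphi\colon C\to C'$ (with left side $[u_1,C,u_2]\colon(w_1)\to(w_2)$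 and right side $[u_1',C',u_2']\colon(w_1')\to(w_2')$) and $\psi\colon D\to D'$ (with left side $[v_1,D,v_2]\colon(w_2)\to(w_3)$ and right side $[v_1',D',v_2']\colon(w_2')\to(w_3')$), let the composite left side be represented by $(u_1\bar v_1,E,v_2\bar u_2)$, where $\bar v_1\colon E\to C$, $\bar u_2\colon E\to D$ satisfy $u_2\bar v_1=v_1\bar u_2$ and $w_2u_2\bar v_1\in W$, and let the composite right side be represented by $(u_1'\bar v_1',E',v_2'\bar u_2')$, where $\bar v_1'\colon E'\to C'$, $\bar u_2'\colon E'\to D'$ satisfy $u_2'\bar v_1'=v_1'\bar u_2'$ and $w_2'u_2'\bar v_1'\in W$; the vertical composite is represented by any $\xi\colon\bar E\to E'$, for an arrow $r\colon\bar E\to E$ in $W$, with $\bar v_1'\xi=\varphi\bar v_1r$ and $\bar u_2'\xi=\psi\bar u_2r$ (left side represented by precomposing with $r$). - Horizontal composition of double cells: choose representatives $\varphi\colon C\to C'$, $\psi\colon C'\to C''$ with the same representative of the common side and compose $\psi\varphi$ in $\mathbf{C}$. These compositions are well defined (in fact there is at most one double cell with any given boundary). *)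

(* Defs.v *)
From mathcomp Require Import all_boot.
From mathcomp Require Import boolp.

Set Implicit Arguments.
Unset Strict Implicit.
Unset Printing Implicit Defensive.

Declare Scope cat_scope.
Delimit Scope cat_scope with cat.
Local Open Scope cat_scope.

(* An element of [Quot R] is an equivalence class, as a predicate on [T]; this
   is only meaningful when [R] is an equivalence relation. *)
Definition Quot (T : Type) (R : T -> T -> Prop) : Type :=
  {P : T -> Prop | exists x, P = R x}.

Definition class (T : Type) (R : T -> T -> Prop) (x : T) : Quot R :=
  exist _ (R x) (ex_intro _ x erefl).

Definition repr (T : Type) (R : T -> T -> Prop) (q : Quot R) : T :=
  projT1 (cid (proj2_sig q)).

Lemma sig_eq (T : Type) (P : T -> Prop) (x y : {x | P x}) :
  proj1_sig x = proj1_sig y -> x = y.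
Proof.
case: x y => [x px] [y py] /= e; case: y / e py => py.
by rewrite (Prop_irrelevance px py).
Qed.

Definition some_of (T : Type) (h : inhabited T) : T :=
  projT1 (cid (let: inhabits x := h in ex_intro (fun=> True) x I)).

Lemma reprK (T : Type) (R : T -> T -> Prop) (q : Quot R) :
  class R (repr q) = q.
Proof. by apply: sig_eq; rewrite /= /repr; case: cid => x /= ->. Qed.

Lemma class_eqP (T : Type) (R : T -> T -> Prop)
    (Rrefl : forall x, R x x) (Rsym : forall x y, R x y -> R y x)
    (Rtrans : forall x y z, R x y -> R y z -> R x z) (x y : T) :
  class R x = class R y <-> R x y.
Proof.
split=> [/(congr1 (@proj1_sig _ _)) /= -> //|Rxy].
apply: sig_eq => /=; apply/funext => z; apply/propext; split.
  exact/Rtrans/Rsym.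
exact: Rtrans.
Qed.

Lemma Quot_total_eq (T : Type) (R : T -> T -> Prop)
    (Rtot : forall x y, R x y) (p q : Quot R) : p = q.
Proof.
rewrite -(reprK p) -(reprK q); apply: sig_eq => /=.
by apply/funext => z; apply/propext; split.
Qed.

Record Category := MkCategory {
  Ob :> Type;
  Hom : Ob -> Ob -> Type;
  idm : forall a, Hom a a;
  compose : forall a b c, Hom b c -> Hom a b -> Hom a c;
  compose_idl : forall a b (f : Hom a b), compose (idm b) f = f;
  compose_idr : forall a b (f : Hom a b), compose f (idm a) = f;
  composeA : forall a b c d (h : Hom c d) (g : Hom b c) (f : Hom a b),
    compose h (compose g f) = compose (compose h g) f }.

Arguments Hom {_} a b.
Arguments idm {_} a.
Notation "g ∘ f" := (compose g f) (at level 40, left associativity) : cat_scope.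

Definition is_iso (C : Category) (a b : C) (f : Hom a b) : Prop :=
  exists g : Hom b a, g ∘ f = idm a /\ f ∘ g = idm b.

(* [arr f] is [f] as an arrow of [C] with unspecified ends, so that arrows of
   different hom-types can be compared: [arr f = arr g] says that [f] and [g]
   have the same domain, the same codomain, and are equal. *)
Definition arr (C : Category) (a b : C) (f : Hom a b) :
    {ab : C * C & Hom ab.1 ab.2} :=
  existT (fun ab : C * C => Hom ab.1 ab.2) (a, b) f.

Record Functor (A B : Category) := MkFunctor {
  fob :> A -> B;
  fhom : forall a b, Hom a b -> Hom (fob a) (fob b);
  fhom_id : forall a, fhom (idm a) = idm (fob a);
  fhom_comp : forall a b c (g : Hom b c) (f : Hom a b),
    fhom (g ∘ f) = fhom g ∘ fhom f }.

Arguments fhom {A B} _ {a b} _.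

Lemma arr_inj (C : Category) (a b : C) (f g : Hom a b) :
  arr f = arr g -> f = g.
Proof.
have H (p q : {ab : C * C & Hom ab.1 ab.2}) (e : p = q) :
    eq_rect _ (fun ab : C * C => Hom ab.1 ab.2) (projT2 p) _
      (congr1 (@projT1 _ _) e) = projT2 q by case: q / e.
move=> e; have := H _ _ e; move: (congr1 _ e) => /= e'.
by rewrite (Prop_irrelevance e' erefl).
Qed.

Lemma arr_ends (C : Category) (a b a' b' : C) (f : Hom a b) (g : Hom a' b') :
  arr f = arr g -> a = a' /\ b = b'.
Proof. by move/(congr1 (@projT1 _ _)) => -[]. Qed.

Lemma arr_comp (C : Category) (a b c a' b' c' : C)
    (f : Hom a b) (g : Hom b c) (f' : Hom a' b') (g' : Hom b' c') :
  arr f = arr f' -> arr g = arr g' -> arr (g ∘ f) = arr (g' ∘ f').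
Proof.
move=> ef eg; have [ea eb] := arr_ends ef; have [_ ec] := arr_ends eg.
subst a' b' c'; by rewrite (arr_inj ef) (arr_inj eg).
Qed.

Lemma arr_fhom (A B : Category) (F : Functor A B) (a b a' b' : A)
    (f : Hom a b) (g : Hom a' b') :
  arr f = arr g -> arr (fhom F f) = arr (fhom F g).
Proof.
by move=> e; have [ea eb] := arr_ends e; subst a' b'; rewrite (arr_inj e).
Qed.

Definition thin (C : Category) : Prop := forall (a b : C) (f g : Hom a b), f = g.

Lemma arr_thin (C : Category) (a b a' b' : C) (f : Hom a b) (g : Hom a' b') :
  thin C -> a = a' -> b = b' -> arr f = arr g.
Proof. by move=> th ea eb; subst a' b'; rewrite (th _ _ f g). Qed.

Lemma functor_eq (A B : Category) (F G : Functor A B) :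
  (forall a, F a = G a) ->
  (forall a b (h : Hom a b), arr (fhom F h) = arr (fhom G h)) -> F = G.
Proof.
case: F G => [F0 F1 Fi Fc] [G0 G1 Gi Gc] /= e0; have e := funext e0.
case: G0 / e {e0} G1 Gi Gc => G1 Gi Gc e1.
have e : F1 = G1.
  apply: functional_extensionality_dep => a.
  apply: functional_extensionality_dep => b.
  by apply: functional_extensionality_dep => h; apply/arr_inj/e1.
case: G1 / e Gi Gc {e1} => Gi Gc.
by rewrite (Prop_irrelevance Fi Gi) (Prop_irrelevance Fc Gc).
Qed.

Definition fid (A : Category) : Functor A A :=
  MkFunctor (fhom := fun a b (h : Hom a b) => h) (fun=> erefl)
    (fun _ _ _ _ _ => erefl).

Lemma fcomp_id (A B D : Category) (G : Functor B D) (F : Functor A B) (a : A) :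
  fhom G (fhom F (idm a)) = idm (G (F a)).
Proof. by rewrite !fhom_id. Qed.

Lemma fcomp_comp (A B D : Category) (G : Functor B D) (F : Functor A B)
    (a b c : A) (g : Hom b c) (f : Hom a b) :
  fhom G (fhom F (g ∘ f)) = fhom G (fhom F g) ∘ fhom G (fhom F f).
Proof. by rewrite !fhom_comp. Qed.

Definition fcomp (A B D : Category) (G : Functor B D) (F : Functor A B) :
    Functor A D :=
  MkFunctor (fhom := fun a b (h : Hom a b) => fhom G (fhom F h))
    (fcomp_id G F) (fcomp_comp G F).

Notation "G ⊚ F" := (fcomp G F) (at level 40, left associativity) : cat_scope.

Lemma fcompA (A B D E : Category) (H : Functor D E) (G : Functor B D)
    (F : Functor A B) : H ⊚ (G ⊚ F) = H ⊚ G ⊚ F.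
Proof. exact: functor_eq. Qed.

Lemma fcomp_idl (A B : Category) (F : Functor A B) : fid B ⊚ F = F.
Proof. exact: functor_eq. Qed.

Lemma fcomp_idr (A B : Category) (F : Functor A B) : F ⊚ fid A = F.
Proof. exact: functor_eq. Qed.

Definition nat_iso (A B : Category) (F G : Functor A B) : Prop :=
  exists eta : forall a, Hom (F a) (G a),
    (forall a b (h : Hom a b), eta b ∘ fhom F h = fhom G h ∘ eta a) /\
    (forall a, is_iso (eta a)).

Definition is_equivalence (A B : Category) (F : Functor A B) : Prop :=
  exists G : Functor B A, nat_iso (G ⊚ F) (fid A) /\ nat_iso (F ⊚ G) (fid B).

Definition Discrete (T : Type) : Category :=
  @MkCategory T (fun a b => a = b) (fun a => erefl a)
    (fun a b c (g : b = c) (f : a = b) => etrans f g)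
    (fun _ _ _ => Prop_irrelevance _ _) (fun _ _ _ => Prop_irrelevance _ _)
    (fun _ _ _ _ _ _ _ => Prop_irrelevance _ _).

Inductive connected (C : Category) : C -> C -> Prop :=
| connected_hom a b : Hom a b -> connected a b
| connected_sym a b : connected a b -> connected b a
| connected_trans a b c : connected a b -> connected b c -> connected a c.

Definition components (C : Category) : Type := Quot (@connected C).

Section Pullback.
Context {A B X : Category} (F : Functor A X) (G : Functor B X).

Definition pb_ob : Type := {p : A * B | F p.1 = G p.2}.

Definition pb_hom (p q : pb_ob) : Type :=
  {h : Hom (sval p).1 (sval q).1 * Hom (sval p).2 (sval q).2 |
    arr (fhom F h.1) = arr (fhom G h.2)}.

Lemma pb_id_subproof (p : pb_ob) :
  arr (fhom F (idm (sval p).1)) = arr (fhom G (idm (sval p).2)).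
Proof. by rewrite !fhom_id (svalP p). Qed.

Definition pb_id (p : pb_ob) : pb_hom p p :=
  exist _ (idm (sval p).1, idm (sval p).2) (pb_id_subproof p).

Lemma pb_comp_subproof (p q r : pb_ob) (g : pb_hom q r) (f : pb_hom p q) :
  arr (fhom F ((sval g).1 ∘ (sval f).1)) =
  arr (fhom G ((sval g).2 ∘ (sval f).2)).
Proof.
by rewrite !fhom_comp; apply: arr_comp; [exact: (svalP f)|exact: (svalP g)].
Qed.

Definition pb_comp (p q r : pb_ob) (g : pb_hom q r) (f : pb_hom p q) :
    pb_hom p r :=
  exist _ ((sval g).1 ∘ (sval f).1, (sval g).2 ∘ (sval f).2)
    (pb_comp_subproof g f).

Definition Pullback : Category.
Proof.
apply: (@MkCategory pb_ob pb_hom pb_id pb_comp).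
- by move=> p q [[f1 f2] e]; apply: sig_eq; rewrite /= !compose_idl.
- by move=> p q [[f1 f2] e]; apply: sig_eq; rewrite /= !compose_idr.
- by move=> p q r s h g f; apply: sig_eq; rewrite /= !composeA.
Defined.

Definition pb1 : Functor Pullback A :=
  @MkFunctor Pullback A (fun p => (sval p).1) (fun p q h => (sval h).1)
    (fun=> erefl) (fun _ _ _ _ _ => erefl).

Definition pb2 : Functor Pullback B :=
  @MkFunctor Pullback B (fun p => (sval p).2) (fun p q h => (sval h).2)
    (fun=> erefl) (fun _ _ _ _ _ => erefl).

Lemma pb_square : F ⊚ pb1 = G ⊚ pb2.
Proof.
by apply: functor_eq => [p|p q h]; [exact: (svalP p)|exact: (svalP h)].
Qed.

Context {Z : Category} (H : Functor Z A) (K : Functor Z B).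
Hypothesis (e : F ⊚ H = G ⊚ K).

Lemma pb_pair_ob_subproof (z : Z) : F (H z) = G (K z).
Proof. exact (congr1 (fun L : Functor Z X => L z) e). Qed.

Definition pb_pair_ob (z : Z) : Pullback :=
  exist _ (H z, K z) (pb_pair_ob_subproof z).

Lemma pb_pair_hom_subproof (z z' : Z) (h : Hom z z') :
  arr (fhom F (fhom H h)) = arr (fhom G (fhom K h)).
Proof. exact (congr1 (fun L : Functor Z X => arr (fhom L h)) e). Qed.

Definition pb_pair_hom (z z' : Z) (h : Hom z z') :
    Hom (pb_pair_ob z) (pb_pair_ob z') :=
  exist _ (fhom H h, fhom K h) (pb_pair_hom_subproof h).

Definition pb_pair : Functor Z Pullback.
Proof.
apply: (@MkFunctor Z Pullback pb_pair_ob pb_pair_hom).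
- by move=> z; apply: sig_eq; rewrite /= !fhom_id.
- by move=> z z' z'' g f; apply: sig_eq; rewrite /= !fhom_comp.
Defined.

End Pullback.

Section InternalCategoryDiagrams.
Context {X0 X1 : Category} (src tgt : Functor X1 X0) (unit : Functor X0 X1).
Context (comp : Functor (Pullback tgt src) X1).

Lemma unitl_square :
  tgt ⊚ unit = fid X0 -> tgt ⊚ (unit ⊚ src) = src ⊚ fid X1.
Proof. by rewrite fcompA => ->; rewrite fcomp_idl fcomp_idr. Qed.

Lemma unitr_square :
  src ⊚ unit = fid X0 -> tgt ⊚ fid X1 = src ⊚ (unit ⊚ tgt).
Proof. by rewrite fcompA => ->; rewrite fcomp_idl fcomp_idr. Qed.

Definition Triples : Category := Pullback (tgt ⊚ pb2 tgt src) src.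
Definition tr12 : Functor Triples (Pullback tgt src) :=
  pb1 (tgt ⊚ pb2 tgt src) src.
Definition tr1 : Functor Triples X1 := pb1 tgt src ⊚ tr12.
Definition tr2 : Functor Triples X1 := pb2 tgt src ⊚ tr12.
Definition tr3 : Functor Triples X1 := pb2 (tgt ⊚ pb2 tgt src) src.

Lemma tr23_square : tgt ⊚ tr2 = src ⊚ tr3.
Proof. by rewrite /tr2 fcompA; apply: pb_square. Qed.

Definition tr23 : Functor Triples (Pullback tgt src) := pb_pair tr23_square.

Lemma assocl_square :
  tgt ⊚ comp = tgt ⊚ pb2 tgt src -> tgt ⊚ (comp ⊚ tr12) = src ⊚ tr3.
Proof. by rewrite fcompA => ->; rewrite -fcompA; apply: tr23_square. Qed.

Lemma assocr_square :
  src ⊚ comp = src ⊚ pb1 tgt src -> tgt ⊚ tr1 = src ⊚ (comp ⊚ tr23).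
Proof.
rewrite fcompA => ->; rewrite -fcompA.
have -> : pb1 tgt src ⊚ tr23 = tr2 by apply: functor_eq.
by rewrite /tr1 /tr2 !fcompA pb_square.
Qed.

End InternalCategoryDiagrams.

(* Internal categories in Cat, functors being compared strictly. *)
Record DoubleCategory := MkDoubleCategory {
  dc0 : Category;   (* objects and vertical arrows *)
  dc1 : Category;   (* horizontal arrows and double cells *)
  dsrc : Functor dc1 dc0;
  dtgt : Functor dc1 dc0;
  dunit : Functor dc0 dc1;
  dcomp : Functor (Pullback dtgt dsrc) dc1;
  dsrc_unit : dsrc ⊚ dunit = fid dc0;
  dtgt_unit : dtgt ⊚ dunit = fid dc0;
  dsrc_comp : dsrc ⊚ dcomp = dsrc ⊚ pb1 dtgt dsrc;
  dtgt_comp : dtgt ⊚ dcomp = dtgt ⊚ pb2 dtgt dsrc;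
  dcomp_unitl : dcomp ⊚ pb_pair (unitl_square dsrc dtgt_unit) = fid dc1;
  dcomp_unitr : dcomp ⊚ pb_pair (unitr_square dtgt dsrc_unit) = fid dc1;
  dcompA : dcomp ⊚ pb_pair (assocl_square dtgt_comp) =
           dcomp ⊚ pb_pair (assocr_square dsrc_comp) }.

(* [Chain n s t] is the [n]-fold fibre product A x_X ... x_X A of n copies of
   [A], consecutive copies being glued along [t] (left) and [s] (right). *)
Section Chain.
Context {A X : Category} (n : nat) (s t : Functor A X).

Definition ch_ob : Type :=
  {a : 'I_n -> A | forall i j : 'I_n, j = i.+1 :> nat -> t (a i) = s (a j)}.

Definition ch_hom (a b : ch_ob) : Type :=
  {h : forall i : 'I_n, Hom (sval a i) (sval b i) |
    forall i j : 'I_n, j = i.+1 :> nat ->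
      arr (fhom t (h i)) = arr (fhom s (h j))}.

Lemma ch_id_subproof (a : ch_ob) (i j : 'I_n) : j = i.+1 :> nat ->
  arr (fhom t (idm (sval a i))) = arr (fhom s (idm (sval a j))).
Proof. by move=> ij; rewrite !fhom_id (svalP a _ _ ij). Qed.

Definition ch_id (a : ch_ob) : ch_hom a a :=
  exist _ (fun i => idm (sval a i)) (@ch_id_subproof a).

Lemma ch_comp_subproof (a b c : ch_ob) (g : ch_hom b c) (f : ch_hom a b)
    (i j : 'I_n) : j = i.+1 :> nat ->
  arr (fhom t (sval g i ∘ sval f i)) = arr (fhom s (sval g j ∘ sval f j)).
Proof.
move=> ij; rewrite !fhom_comp.
by apply: arr_comp; [exact: (svalP f _ _ ij)|exact: (svalP g _ _ ij)].
Qed.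

Definition ch_comp (a b c : ch_ob) (g : ch_hom b c) (f : ch_hom a b) :
    ch_hom a c :=
  exist _ (fun i => sval g i ∘ sval f i) (@ch_comp_subproof a b c g f).

Definition Chain : Category.
Proof.
apply: (@MkCategory ch_ob ch_hom ch_id ch_comp).
- move=> a b f; apply: sig_eq; apply: functional_extensionality_dep => i /=.
  exact: compose_idl.
- move=> a b f; apply: sig_eq; apply: functional_extensionality_dep => i /=.
  exact: compose_idr.
- move=> a b c d h g f; apply: sig_eq.
  by apply: functional_extensionality_dep => i /=; apply: composeA.
Defined.

End Chain.

Section ChainMap.
Context {A X Y : Category} (n : nat) (s t : Functor A X) (gamma : Functor X Y).

Lemma chain_map_ob_subproof (a : Chain n s t) (i j : 'I_n) :
  j = i.+1 :> nat -> gamma (t (sval a i)) = gamma (s (sval a j)).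
Proof. by move=> ij; rewrite (svalP a _ _ ij). Qed.

Definition chain_map_ob (a : Chain n s t) : Chain n (gamma ⊚ s) (gamma ⊚ t) :=
  exist _ (sval a) (@chain_map_ob_subproof a).

Lemma chain_map_hom_subproof (a b : Chain n s t) (h : Hom a b) (i j : 'I_n) :
  j = i.+1 :> nat ->
  arr (fhom gamma (fhom t (sval h i))) = arr (fhom gamma (fhom s (sval h j))).
Proof.
by move=> ij; apply/arr_fhom/(svalP h _ _ ij).
Qed.

Definition chain_map_hom (a b : Chain n s t) (h : Hom a b) :
    Hom (chain_map_ob a) (chain_map_ob b) :=
  exist _ (sval h) (@chain_map_hom_subproof a b h).

Definition chain_map : Functor (Chain n s t) (Chain n (gamma ⊚ s) (gamma ⊚ t)).
Proof.
apply: (@MkFunctor _ (Chain n (gamma ⊚ s) (gamma ⊚ t))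
         chain_map_ob chain_map_hom).
- by move=> a; apply: sig_eq.
- by move=> a b c g f; apply: sig_eq.
Defined.

End ChainMap.

Definition weakly_globular (D : DoubleCategory) : Prop :=
  exists gamma : Functor (dc0 D) (Discrete (components (dc0 D))),
    is_equivalence gamma /\
    forall n : nat, 2 <= n ->
      is_equivalence (chain_map n (dsrc D) (dtgt D) gamma).

Definition ArrowClass (C : Category) : Type :=
  forall a b : C, Hom a b -> Prop.

Section Conditions.
Context {C : Category} (W : ArrowClass C).

Definition CF1 : Prop :=
  (forall (a b : C) (f : Hom a b), is_iso f -> W f) /\
  (forall (a b c : C) (g : Hom b c) (f : Hom a b), W g -> W f -> W (g ∘ f)).

Definition CF2 : Prop :=
  forall (a b c : C) (f : Hom c b) (w : Hom a b), W w ->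
    exists (d : C) (f' : Hom d a) (w' : Hom d c), W w' /\ w ∘ f' = f ∘ w'.

Definition CF3 : Prop :=
  forall (a b c : C) (w : Hom b c) (f g : Hom a b), W w -> w ∘ f = w ∘ g ->
    exists (d : C) (w' : Hom d a), W w' /\ f ∘ w' = g ∘ w'.

End Conditions.

Section Spans.
Context {C : Category} (W : ArrowClass C).

Record WObj := MkWObj {
  wdom : C;
  wcod : C;
  warr : Hom wdom wcod;
  warrP : W warr }.

(* Representatives of vertical arrows.  The equation [vsp_comm] forces [w1]
   and [w2] to have the same codomain. *)
Record VSpan (w1 w2 : WObj) := MkVSpan {
  apex : C;
  leg1 : Hom apex (wdom w1);
  leg2 : Hom apex (wdom w2);
  vsp_comm : arr (warr w1 ∘ leg1) = arr (warr w2 ∘ leg2);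
  vsp_W : W (warr w1 ∘ leg1) }.

Definition vspan_eq (w1 w2 : WObj) (u v : VSpan w1 w2) : Prop :=
  exists (E : C) (r1 : Hom E (apex u)) (r2 : Hom E (apex v)),
    [/\ leg1 u ∘ r1 = leg1 v ∘ r2, leg2 u ∘ r1 = leg2 v ∘ r2
      & W (warr w1 ∘ leg1 u ∘ r1)].

Definition VArr (w1 w2 : WObj) : Type := Quot (@vspan_eq w1 w2).

Definition varr (w1 w2 : WObj) (u : VSpan w1 w2) : VArr w1 w2 :=
  class (@vspan_eq w1 w2) u.

Record VSquare (w1 w2 w3 : WObj) (u : VSpan w1 w2) (v : VSpan w2 w3) :=
  MkVSquare {
    sq_apex : C;
    sq1 : Hom sq_apex (apex u);
    sq2 : Hom sq_apex (apex v);
    sq_comm : leg2 u ∘ sq1 = leg1 v ∘ sq2;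
    sq_W : W (warr w2 ∘ leg2 u ∘ sq1) }.

(* Representatives of double cells
             f1
      (w1) ------> (w1')
       |x            |x'
      (w2) ------> (w2')
             f2                                                            *)
Record CellRep (w1 w1' w2 w2' : WObj)
    (f1 : Hom (wdom w1) (wdom w1')) (f2 : Hom (wdom w2) (wdom w2'))
    (x : VArr w1 w2) (x' : VArr w1' w2') := MkCellRep {
  lrep : VSpan w1 w2;
  rrep : VSpan w1' w2';
  lrepP : varr lrep = x;
  rrepP : varr rrep = x';
  cell_arr : Hom (apex lrep) (apex rrep);
  cell_top : f1 ∘ leg1 lrep = leg1 rrep ∘ cell_arr;
  cell_bot : f2 ∘ leg2 lrep = leg2 rrep ∘ cell_arr }.

Definition cell_eq w1 w1' w2 w2' f1 f2 x x'
    (p q : @CellRep w1 w1' w2 w2' f1 f2 x x') : Prop :=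
  exists (E E' : C) (r : Hom E (apex (lrep p))) (s : Hom E (apex (lrep q)))
    (r' : Hom E' (apex (rrep p))) (s' : Hom E' (apex (rrep q)))
    (chi : Hom E E'),
    [/\ cell_arr p ∘ r = r' ∘ chi /\ cell_arr q ∘ s = s' ∘ chi,
        leg1 (lrep p) ∘ r = leg1 (lrep q) ∘ s /\
        leg2 (lrep p) ∘ r = leg2 (lrep q) ∘ s,
        leg1 (rrep p) ∘ r' = leg1 (rrep q) ∘ s' /\
        leg2 (rrep p) ∘ r' = leg2 (rrep q) ∘ s',
        W (warr w1 ∘ leg1 (lrep p) ∘ r)
      & W (warr w1' ∘ leg1 (rrep p) ∘ r')].

Definition Cell w1 w1' w2 w2' f1 f2 x x' : Type :=
  Quot (@cell_eq w1 w1' w2 w2' f1 f2 x x').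

Definition cell w1 w1' w2 w2' f1 f2 x x'
    (p : @CellRep w1 w1' w2 w2' f1 f2 x x') : Cell f1 f2 x x' :=
  class (@cell_eq w1 w1' w2 w2' f1 f2 x x') p.

(* The data of a vertical composite of two double cells: the composite sides
   are represented by the squares [L] and [R], and [vc_arr] represents the
   composite cell. *)
Record VCompData w1 w2 w3 w1' w2' w3'
    (f1 : Hom (wdom w1) (wdom w1')) (f2 : Hom (wdom w2) (wdom w2'))
    (f3 : Hom (wdom w3) (wdom w3'))
    x y x' y' (p : CellRep f1 f2 x x') (q : CellRep f2 f3 y y')
    (L : VSquare (lrep p) (lrep q)) (R : VSquare (rrep p) (rrep q)) :=
  MkVCompData {
    vc_apex : C;
    vc_w : Hom vc_apex (sq_apex L);
    vc_wP : W vc_w;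
    vc_arr : Hom vc_apex (sq_apex R);
    vc_eq1 : sq1 R ∘ vc_arr = cell_arr p ∘ sq1 L ∘ vc_w;
    vc_eq2 : sq2 R ∘ vc_arr = cell_arr q ∘ sq2 L ∘ vc_w }.

Record HArr := MkHArr {
  hsrc : WObj;
  htgt : WObj;
  harr : Hom (wdom hsrc) (wdom htgt) }.

Definition hid (w : WObj) : HArr := MkHArr (idm (wdom w)).

Definition hcomp (f g : HArr) (e : htgt f = hsrc g) : HArr :=
  MkHArr (harr g ∘ eq_rect (htgt f) (fun w => Hom (wdom (hsrc f)) (wdom w))
                     (harr f) (hsrc g) e).

Record DCell (f1 f2 : HArr) := MkDCell {
  dleft : VArr (hsrc f1) (hsrc f2);
  dright : VArr (htgt f1) (htgt f2);
  dcell : Cell (harr f1) (harr f2) dleft dright }.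

End Spans.

Arguments MkCellRep {C W w1 w1' w2 w2' f1 f2 x x' lrep rrep}.

Section CW.
Context {C : Category} {W : ArrowClass C}.
Hypotheses (cf1 : CF1 W) (cf2 : CF2 W) (cf3 : CF3 W).

Let Wcomp (a b c : C) (g : Hom b c) (f : Hom a b) : W g -> W f -> W (g ∘ f) :=
  proj2 cf1 a b c g f.

Lemma Wid (a : C) : W (idm a).
Proof. by apply: (proj1 cf1); exists (idm a); rewrite compose_idl. Qed.

Lemma W_arr (a b a' b' : C) (f : Hom a b) (g : Hom a' b') :
  arr f = arr g -> W f -> W g.
Proof.
by move=> e; have [ea eb] := arr_ends e; subst a' b'; rewrite (arr_inj e).
Qed.

Lemma leg2_W (w1 w2 : WObj W) (u : VSpan w1 w2) : W (warr w2 ∘ leg2 u).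
Proof. exact: W_arr (vsp_comm u) (vsp_W u). Qed.

Section Restrict.
Context (w1 w2 : WObj W) (u : VSpan w1 w2) (E : C) (r : Hom E (apex u)).
Hypothesis (Wr : W r).

Lemma restrict_comm :
  arr (warr w1 ∘ (leg1 u ∘ r)) = arr (warr w2 ∘ (leg2 u ∘ r)).
Proof. by rewrite !composeA; apply: arr_comp => //; apply: vsp_comm. Qed.

Lemma restrict_W : W (warr w1 ∘ (leg1 u ∘ r)).
Proof. by rewrite composeA; apply: (Wcomp _ Wr); apply: vsp_W. Qed.

Definition restrict : VSpan w1 w2 := MkVSpan restrict_comm restrict_W.

End Restrict.

Lemma vspan_total (w1 w2 : WObj W) (u v : VSpan w1 w2) : vspan_eq u v.
Proof.
have [E [r2 [r1 [Wr1 e]]]] := cf2 (warr w1 ∘ leg1 u) (vsp_W v).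
have [F [t [Wt et]]] : exists F (t : Hom F E),
    W t /\ leg1 v ∘ r2 ∘ t = leg1 u ∘ r1 ∘ t.
  by apply: cf3 (warrP w1) _; rewrite !composeA.
have [G [t' [Wt' et']]] : exists G (t' : Hom G F),
    W t' /\ leg2 v ∘ r2 ∘ t ∘ t' = leg2 u ∘ r1 ∘ t ∘ t'.
  apply: cf3 (warrP w2) _; apply: arr_inj; rewrite !composeA.
  apply: arr_comp => //.
  apply: etrans (_ : arr (warr w1 ∘ leg1 v ∘ r2) = _).
    by apply: arr_comp => //; rewrite vsp_comm.
  by rewrite e; apply: arr_comp => //; rewrite vsp_comm.
exists G, (r1 ∘ t ∘ t'), (r2 ∘ t ∘ t'); split.
- by rewrite !composeA -et.
- by rewrite !composeA -et'.
- by rewrite !composeA; do 3 apply: (Wcomp _) => //; apply: vsp_W.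
Qed.

Lemma VArr_thin (w1 w2 : WObj W) (x y : VArr w1 w2) : x = y.
Proof. exact/Quot_total_eq/vspan_total. Qed.

Lemma cell_total (w1 w1' w2 w2' : WObj W) (f1 : Hom (wdom w1) (wdom w1'))
    (f2 : Hom (wdom w2) (wdom w2')) x x' (p q : CellRep f1 f2 x x') :
  cell_eq p q.
Proof.
have [E [r [s [e1 e2 Wr]]]] := vspan_total (lrep p) (lrep q).
have [E' [r' [s' [e1' e2' Wr']]]] := vspan_total (rrep p) (rrep q).
have [F [chi [v [Wv e]]]] :=
  cf2 (warr w1' ∘ leg1 (rrep p) ∘ cell_arr p ∘ r) Wr'.
have [G [t [Wt et]]] : exists G (t : Hom G F),
    W t /\ r' ∘ chi ∘ t = cell_arr p ∘ r ∘ v ∘ t.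
  by apply: cf3 (vsp_W (rrep p)) _; rewrite !composeA.
have [H [t' [Wt' et']]] : exists H (t' : Hom H G),
    W t' /\ s' ∘ chi ∘ t ∘ t' = cell_arr q ∘ s ∘ v ∘ t ∘ t'.
  have [H [t' [Wt' et']]] : exists H (t' : Hom H G),
    W t' /\ (s' ∘ chi ∘ t) ∘ t' = (cell_arr q ∘ s ∘ v ∘ t) ∘ t'.
    apply: cf3 (vsp_W (rrep q)) _; rewrite -!composeA; congr (_ ∘ _).
    rewrite !composeA -e1' -cell_top -(composeA f1) -e1 composeA cell_top.
    by rewrite -!composeA; congr (_ ∘ _); rewrite !composeA.
  by exists H, t'.
exists H, E', (r ∘ v ∘ t ∘ t'), (s ∘ v ∘ t ∘ t'), r', s', (chi ∘ t ∘ t').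
split=> //.
- by rewrite !composeA -et -et'.
- by rewrite !composeA e1 e2.
- by rewrite !composeA; do 3 apply: (Wcomp _) => //.
Qed.

Lemma Cell_thin (w1 w1' w2 w2' : WObj W) (f1 : Hom (wdom w1) (wdom w1'))
    (f2 : Hom (wdom w2) (wdom w2')) x x' (a b : Cell f1 f2 x x') : a = b.
Proof. exact/Quot_total_eq/cell_total. Qed.

Lemma vid_W (w : WObj W) : W (warr w ∘ idm (wdom w)).
Proof. by rewrite compose_idr; apply: warrP. Qed.

Definition vid_span (w : WObj W) : VSpan w w :=
  MkVSpan (erefl (arr (warr w ∘ idm (wdom w)))) (vid_W w).

Definition vid (w : WObj W) : VArr w w := varr (vid_span w).

Section VSquareSpan.
Context (w1 w2 w3 : WObj W) (u : VSpan w1 w2) (v : VSpan w2 w3).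

Lemma vsquare_exists : inhabited (VSquare u v).
Proof.
have [E [g [f [Wf e]]]] := cf2 (warr w2 ∘ leg2 u) (vsp_W v).
have [F [t [Wt et]]] : exists F (t : Hom F E),
    W t /\ leg1 v ∘ g ∘ t = leg2 u ∘ f ∘ t.
  by apply: cf3 (warrP w2) _; rewrite !composeA.
apply: inhabits; apply: (@MkVSquare _ _ _ _ _ u v F (f ∘ t) (g ∘ t)).
  by rewrite !composeA.
by rewrite !composeA; do 2 apply: (Wcomp _) => //; apply: leg2_W.
Qed.

Context (S : VSquare u v).

Lemma vsquare_comm :
  arr (warr w1 ∘ (leg1 u ∘ sq1 S)) = arr (warr w3 ∘ (leg2 v ∘ sq2 S)).
Proof.
rewrite !composeA; apply: etrans (_ : arr (warr w2 ∘ leg2 u ∘ sq1 S) = _).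
  by apply: arr_comp => //; apply: vsp_comm.
rewrite -(composeA (warr w2)) sq_comm composeA.
by apply: arr_comp => //; apply: vsp_comm.
Qed.

Lemma vsquare_W : W (warr w1 ∘ (leg1 u ∘ sq1 S)).
Proof.
apply: W_arr (sq_W S); rewrite composeA; apply: arr_comp => //.
by rewrite vsp_comm.
Qed.

Definition vsquare_span : VSpan w1 w3 := MkVSpan vsquare_comm vsquare_W.

End VSquareSpan.

Definition vsquare w1 w2 w3 (u : VSpan w1 w2) (v : VSpan w2 w3) : VSquare u v :=
  some_of (vsquare_exists u v).

(* By [vcompE] below, the result does not depend on the representatives and the
   square that are picked; likewise for [vcell_comp] and [hcell_comp]. *)
Definition vcomp (w1 w2 w3 : WObj W) (y : VArr w2 w3) (x : VArr w1 w2) :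
    VArr w1 w3 :=
  varr (vsquare_span (vsquare (repr x) (repr y))).

Lemma vcompE (w1 w2 w3 : WObj W) (u : VSpan w1 w2) (v : VSpan w2 w3)
    (S : VSquare u v) :
  vcomp (varr v) (varr u) = varr (vsquare_span S).
Proof. exact: VArr_thin. Qed.

Definition CW0 : Category :=
  @MkCategory (WObj W) (@VArr C W) vid vcomp
    (fun _ _ _ => VArr_thin _ _) (fun _ _ _ => VArr_thin _ _)
    (fun _ _ _ _ _ _ _ => VArr_thin _ _).

Lemma CW0_thin : thin CW0.
Proof. exact: VArr_thin. Qed.

Lemma vid_cell_subproof (w v : WObj W) (f : Hom (wdom w) (wdom v)) :
  f ∘ idm (wdom w) = idm (wdom v) ∘ f.
Proof. by rewrite compose_idl compose_idr. Qed.

Definition vid_cellrep (w v : WObj W) (f : Hom (wdom w) (wdom v)) :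
    CellRep f f (vid w) (vid v) :=
  @MkCellRep _ _ _ _ _ _ f f (vid w) (vid v) (vid_span w) (vid_span v) erefl erefl f
    (vid_cell_subproof f) (vid_cell_subproof f).

Definition vid_cell (f : HArr W) : DCell f f :=
  MkDCell (cell (vid_cellrep (harr f))).

Section VCellComp.
Context (w1 w2 w3 w1' w2' w3' : WObj W).
Context (f1 : Hom (wdom w1) (wdom w1')) (f2 : Hom (wdom w2) (wdom w2')).
Context (f3 : Hom (wdom w3) (wdom w3')).
Context (x : VArr w1 w2) (y : VArr w2 w3) (x' : VArr w1' w2') (y' : VArr w2' w3').
Context (p : CellRep f1 f2 x x') (q : CellRep f2 f3 y y').

Lemma vcompdata_exists (L : VSquare (lrep p) (lrep q))
    (R : VSquare (rrep p) (rrep q)) : inhabited (VCompData L R).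
Proof.
have [E [xi [r [Wr e]]]] :=
  cf2 (warr w2' ∘ leg2 (rrep p) ∘ cell_arr p ∘ sq1 L) (sq_W R).
have [F [t [Wt et]]] : exists F (t : Hom F E),
    W t /\ sq1 R ∘ xi ∘ t = cell_arr p ∘ sq1 L ∘ r ∘ t.
  by apply: cf3 (leg2_W (rrep p)) _; rewrite !composeA.
have [G [t' [Wt' et']]] : exists G (t' : Hom G F),
    W t' /\ (sq2 R ∘ xi ∘ t) ∘ t' = (cell_arr q ∘ sq2 L ∘ r ∘ t) ∘ t'.
  apply: cf3 (vsp_W (rrep q)) _; rewrite -!composeA; congr (_ ∘ _).
  rewrite !composeA -sq_comm -cell_top -(composeA f2) -sq_comm composeA.
  by rewrite cell_bot -!composeA; congr (_ ∘ _); rewrite !composeA.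
apply: inhabits.
apply: (@MkVCompData _ _ _ _ _ _ _ _ _ _ _ _ _ _ _ p q L R G (r ∘ t ∘ t') _ (xi ∘ t ∘ t')).
- by do 2 apply: (Wcomp _) => //.
- by rewrite !composeA et.
- by rewrite !composeA et'.
Qed.

Context (L : VSquare (lrep p) (lrep q)) (R : VSquare (rrep p) (rrep q)).
Context (d : VCompData L R).

Let Lspan := vsquare_span L.
Let Rspan := vsquare_span R.

Definition vcell_left : VSpan w1 w3 := @restrict _ _ Lspan _ (vc_w d) (vc_wP d).

Lemma vcell_top : f1 ∘ leg1 vcell_left = leg1 Rspan ∘ vc_arr d.
Proof. by rewrite /= -(composeA _ (sq1 R)) vc_eq1 !composeA cell_top. Qed.

Lemma vcell_bot : f3 ∘ leg2 vcell_left = leg2 Rspan ∘ vc_arr d.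
Proof. by rewrite /= -(composeA _ (sq2 R)) vc_eq2 !composeA cell_bot. Qed.

Definition vcell_rep : CellRep f1 f3 (vcomp y x) (vcomp y' x') :=
  @MkCellRep _ _ _ _ _ _ f1 f3 (vcomp y x) (vcomp y' x') vcell_left Rspan
    (VArr_thin _ _) (VArr_thin _ _) (vc_arr d) vcell_top vcell_bot.

End VCellComp.

Definition vcompdata w1 w2 w3 w1' w2' w3' f1 f2 f3 x y x' y'
    (p : @CellRep C W w1 w1' w2 w2' f1 f2 x x')
    (q : @CellRep C W w2 w2' w3 w3' f2 f3 y y') :
    VCompData (vsquare (lrep p) (lrep q)) (vsquare (rrep p) (rrep q)) :=
  some_of (vcompdata_exists _ _).

Definition vcell_comp w1 w2 w3 w1' w2' w3' f1 f2 f3 x y x' y'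
    (b : @Cell C W w2 w2' w3 w3' f2 f3 y y')
    (a : @Cell C W w1 w1' w2 w2' f1 f2 x x') :
    Cell f1 f3 (vcomp y x) (vcomp y' x') :=
  cell (vcell_rep (vcompdata (repr a) (repr b))).

Lemma vcell_compE w1 w2 w3 w1' w2' w3' f1 f2 f3 x y x' y'
    (p : @CellRep C W w1 w1' w2 w2' f1 f2 x x')
    (q : @CellRep C W w2 w2' w3 w3' f2 f3 y y')
    (L : VSquare (lrep p) (lrep q)) (R : VSquare (rrep p) (rrep q))
    (d : VCompData L R) :
  vcell_comp (cell q) (cell p) = cell (vcell_rep d).
Proof. exact: Cell_thin. Qed.

Definition dvcomp (f1 f2 f3 : HArr W) (b : DCell f2 f3) (a : DCell f1 f2) :
    DCell f1 f3 :=
  MkDCell (vcell_comp (dcell b) (dcell a)).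

Lemma DCell_thin (f1 f2 : HArr W) (a b : DCell f1 f2) : a = b.
Proof.
case: a b => [x x' a] [y y' b].
have e := VArr_thin x y; subst y; have e := VArr_thin x' y'; subst y'.
by rewrite (Cell_thin a b).
Qed.

Definition CW1 : Category :=
  @MkCategory (HArr W) (@DCell C W) vid_cell dvcomp
    (fun _ _ _ => DCell_thin _ _) (fun _ _ _ => DCell_thin _ _)
    (fun _ _ _ _ _ _ _ => DCell_thin _ _).

Lemma CW1_thin : thin CW1.
Proof. exact: DCell_thin. Qed.

Definition CWsrc : Functor CW1 CW0 :=
  @MkFunctor CW1 CW0 (@hsrc C W) (@dleft C W)
    (fun=> erefl) (fun _ _ _ _ _ => erefl).

Definition CWtgt : Functor CW1 CW0 :=
  @MkFunctor CW1 CW0 (@htgt C W) (@dright C W)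
    (fun=> erefl) (fun _ _ _ _ _ => erefl).

Lemma hid_cell_subproof (a b : C) (f : Hom a b) : idm b ∘ f = f ∘ idm a.
Proof. by rewrite compose_idl compose_idr. Qed.

Definition hid_cellrep (w1 w2 : WObj W) (u : VSpan w1 w2) :
    CellRep (idm (wdom w1)) (idm (wdom w2)) (varr u) (varr u) :=
  @MkCellRep _ _ _ _ _ _ (idm (wdom w1)) (idm (wdom w2)) (varr u) (varr u)
    u u erefl erefl (idm (apex u))
    (hid_cell_subproof (leg1 u)) (hid_cell_subproof (leg2 u)).

Definition hid_cell (w1 w2 : WObj W) (x : VArr w1 w2) : DCell (hid w1) (hid w2) :=
  @MkDCell C W (hid w1) (hid w2) _ _ (cell (hid_cellrep (repr x))).

Definition CWunit : Functor CW0 CW1 :=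
  @MkFunctor CW0 CW1 (@hid C W) hid_cell
    (fun=> DCell_thin _ _) (fun _ _ _ _ _ => DCell_thin _ _).

Section HCellComp.
Context (w1 w1' w1'' w2 w2' w2'' : WObj W).
Context (f1 : Hom (wdom w1) (wdom w1')) (f2 : Hom (wdom w2) (wdom w2')).
Context (g1 : Hom (wdom w1') (wdom w1'')) (g2 : Hom (wdom w2') (wdom w2'')).
Context (x : VArr w1 w2) (x' : VArr w1' w2') (x'' : VArr w1'' w2'').

(* Representatives [phi : C -> C'] and [psi : C' -> C''] of the cells [a] and
   [b] with the same representative of the common side. *)
Record HCompData (a : Cell f1 f2 x x') (b : Cell g1 g2 x' x'') := MkHCompData {
  hc_l : VSpan w1 w2;
  hc_m : VSpan w1' w2';
  hc_r : VSpan w1'' w2'';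
  hc_lP : varr hc_l = x;
  hc_mP : varr hc_m = x';
  hc_rP : varr hc_r = x'';
  hc_phi : Hom (apex hc_l) (apex hc_m);
  hc_psi : Hom (apex hc_m) (apex hc_r);
  hc_phi1 : f1 ∘ leg1 hc_l = leg1 hc_m ∘ hc_phi;
  hc_phi2 : f2 ∘ leg2 hc_l = leg2 hc_m ∘ hc_phi;
  hc_psi1 : g1 ∘ leg1 hc_m = leg1 hc_r ∘ hc_psi;
  hc_psi2 : g2 ∘ leg2 hc_m = leg2 hc_r ∘ hc_psi;
  hc_a : cell (MkCellRep hc_lP hc_mP hc_phi hc_phi1 hc_phi2) = a;
  hc_b : cell (MkCellRep hc_mP hc_rP hc_psi hc_psi1 hc_psi2) = b }.

Lemma hcompdata_exists (a : Cell f1 f2 x x') (b : Cell g1 g2 x' x'') :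
  inhabited (HCompData a b).
Proof.
case: (repr a) => [u u' _ _ phi et eb]; case: (repr b) => [v v' ev ev' psi et' eb'].
have [E [h [r [Wr e]]]] := cf2 (warr w1' ∘ leg1 u' ∘ phi) (vsp_W v).
have [F [t [Wt ett]]] : exists F (t : Hom F E),
    W t /\ leg1 v ∘ h ∘ t = leg1 u' ∘ phi ∘ r ∘ t.
  by apply: cf3 (warrP w1') _; rewrite !composeA.
have [G [t' [Wt' ett']]] : exists G (t' : Hom G F),
    W t' /\ leg2 v ∘ h ∘ t ∘ t' = leg2 u' ∘ phi ∘ r ∘ t ∘ t'.
  apply: cf3 (warrP w2') _; apply: arr_inj; rewrite !composeA.
  apply: arr_comp => //.
  apply: etrans (_ : arr (warr w1' ∘ leg1 v ∘ h) = _).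
    by apply: arr_comp => //; rewrite vsp_comm.
  by rewrite e; do 2 apply: arr_comp => //; rewrite vsp_comm.
set k := r ∘ t ∘ t'.
have Wk : W k by do 2 apply: (Wcomp _) => //.
pose l := @restrict _ _ u _ k Wk.
have h1 : f1 ∘ leg1 l = leg1 v ∘ (h ∘ t ∘ t').
  by rewrite /= /k !composeA et -ett.
have h2 : f2 ∘ leg2 l = leg2 v ∘ (h ∘ t ∘ t').
  by rewrite /= /k !composeA eb -ett'.
apply: inhabits.
exact: (@MkHCompData _ _ l v v' (VArr_thin _ _) ev ev' (h ∘ t ∘ t') psi
  h1 h2 et' eb' (Cell_thin _ _) (Cell_thin _ _)).
Qed.

Section Rep.
Context (a : Cell f1 f2 x x') (b : Cell g1 g2 x' x'') (d : HCompData a b).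

Lemma hcell_top :
  g1 ∘ f1 ∘ leg1 (hc_l d) = leg1 (hc_r d) ∘ (hc_psi d ∘ hc_phi d).
Proof. by rewrite -composeA hc_phi1 composeA hc_psi1 composeA. Qed.

Lemma hcell_bot :
  g2 ∘ f2 ∘ leg2 (hc_l d) = leg2 (hc_r d) ∘ (hc_psi d ∘ hc_phi d).
Proof. by rewrite -composeA hc_phi2 composeA hc_psi2 composeA. Qed.

Definition hcell_rep : CellRep (g1 ∘ f1) (g2 ∘ f2) x x'' :=
  MkCellRep (hc_lP d) (hc_rP d) (hc_psi d ∘ hc_phi d) hcell_top hcell_bot.

End Rep.

Definition hcompdata (a : Cell f1 f2 x x') (b : Cell g1 g2 x' x'') :
    HCompData a b :=
  some_of (hcompdata_exists a b).

Definition hcell_comp (a : Cell f1 f2 x x') (b : Cell g1 g2 x' x'') :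
    Cell (g1 ∘ f1) (g2 ∘ f2) x x'' :=
  cell (hcell_rep (hcompdata a b)).

Lemma hcell_compE (a : Cell f1 f2 x x') (b : Cell g1 g2 x' x'')
    (d : HCompData a b) : hcell_comp a b = cell (hcell_rep d).
Proof. exact: Cell_thin. Qed.

End HCellComp.

(* The hypothesis of [hcomp_cell] identifies the right side of the first cell
   with the left side of the second; eliminating the equalities reduces
   [hcomp_cell] to [hcell_comp]. *)
Definition hcomp_cell (f f' g g' : HArr W)
    (e : htgt f = hsrc g) (e' : htgt f' = hsrc g')
    (a : DCell f f') (b : DCell g g') :
  @arr CW0 _ _ (dright a) = @arr CW0 _ _ (dleft b) ->
  DCell (hcomp e) (hcomp e').
Proof.
case: f e a => w v f; case: f' e' => w' v' f'.
case: g b => v1 u g; case: g' => v1' u' g' /= b e' e.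
case: v1 / e g b => g b; case: v1' / e' g' b => g' b.
case: b => y1 z b [x y a] /= /(@arr_inj CW0 _ _ y y1) yy1.
case: y1 / yy1 b => b.
exact: (@MkDCell C W (@hcomp C W (MkHArr f) (MkHArr g) erefl)
          (@hcomp C W (MkHArr f') (MkHArr g') erefl) x z (hcell_comp a b)).
Defined.

Lemma hcomp_cellE (w v u w' v' u' : WObj W)
    (f : Hom (wdom w) (wdom v)) (g : Hom (wdom v) (wdom u))
    (f' : Hom (wdom w') (wdom v')) (g' : Hom (wdom v') (wdom u'))
    (x : VArr w w') (y : VArr v v') (z : VArr u u')
    (a : Cell f f' x y) (b : Cell g g' y z) :
  @hcomp_cell (MkHArr f) (MkHArr f') (MkHArr g) (MkHArr g') erefl erefl
    (@MkDCell C W (MkHArr f) (MkHArr f') x y a)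
    (@MkDCell C W (MkHArr g) (MkHArr g') y z b) erefl =
  @MkDCell C W (MkHArr (g ∘ f)) (MkHArr (g' ∘ f')) x z (hcell_comp a b).
Proof. exact: DCell_thin. Qed.

Definition CWcomp_ob (p : Pullback CWtgt CWsrc) : CW1 := hcomp (svalP p).

Definition CWcomp_hom (p q : Pullback CWtgt CWsrc) (h : Hom p q) :
    Hom (CWcomp_ob p) (CWcomp_ob q) :=
  hcomp_cell (svalP p) (svalP q) (svalP h).

Definition CWcomp : Functor (Pullback CWtgt CWsrc) CW1 :=
  @MkFunctor (Pullback CWtgt CWsrc) CW1 CWcomp_ob CWcomp_hom
    (fun=> DCell_thin _ _) (fun _ _ _ _ _ => DCell_thin _ _).

Lemma functor_eq_thin (A B : Category) (F G : Functor A B) :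
  thin B -> (forall a, F a = G a) -> F = G.
Proof. by move=> th e; apply: functor_eq => // a b h; apply: arr_thin. Qed.

Lemma CWsrc_unit : CWsrc ⊚ CWunit = fid CW0.
Proof. exact: functor_eq_thin CW0_thin _. Qed.

Lemma CWtgt_unit : CWtgt ⊚ CWunit = fid CW0.
Proof. exact: functor_eq_thin CW0_thin _. Qed.

Lemma CWsrc_comp : CWsrc ⊚ CWcomp = CWsrc ⊚ pb1 CWtgt CWsrc.
Proof. exact: functor_eq_thin CW0_thin _. Qed.

Lemma CWtgt_comp : CWtgt ⊚ CWcomp = CWtgt ⊚ pb2 CWtgt CWsrc.
Proof. exact: functor_eq_thin CW0_thin _. Qed.

Lemma hcomp_idl (f : HArr W) (e : htgt (hid (hsrc f)) = hsrc f) :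
  hcomp e = f.
Proof.
case: f e => w v f /= e; rewrite (Prop_irrelevance e erefl) /hcomp /=.
by rewrite compose_idr.
Qed.

Lemma hcomp_idr (f : HArr W) (e : htgt f = hsrc (hid (htgt f))) :
  hcomp e = f.
Proof.
case: f e => w v f /= e; rewrite (Prop_irrelevance e erefl) /hcomp /=.
by rewrite compose_idl.
Qed.

Lemma hcompA (f g h : HArr W) (e1 : htgt f = hsrc g) (e2 : htgt g = hsrc h)
    (e3 : htgt (hcomp e1) = hsrc h) (e4 : htgt f = hsrc (hcomp e2)) :
  hcomp e3 = hcomp e4.
Proof.
case: f e1 e3 e4 => w v f /=; case: h e2 => u t h /=; case: g => v1 u1 g /=.
move=> e2 e1; case: v1 / e1 g => g; case: u / e2 h => h e3 e4.
rewrite (Prop_irrelevance e3 erefl) (Prop_irrelevance e4 erefl) /hcomp /=.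
by rewrite composeA.
Qed.

Lemma CWcomp_unitl :
  CWcomp ⊚ pb_pair (unitl_square CWsrc CWtgt_unit) = fid CW1.
Proof. by apply: functor_eq_thin CW1_thin _ => f; apply: hcomp_idl. Qed.

Lemma CWcomp_unitr :
  CWcomp ⊚ pb_pair (unitr_square CWtgt CWsrc_unit) = fid CW1.
Proof. by apply: functor_eq_thin CW1_thin _ => f; apply: hcomp_idr. Qed.

Lemma CWcompA :
  CWcomp ⊚ pb_pair (assocl_square CWtgt_comp) =
  CWcomp ⊚ pb_pair (assocr_square CWsrc_comp).
Proof. by apply: functor_eq_thin CW1_thin _ => p; apply: hcompA. Qed.

Definition CW : DoubleCategory :=
  @MkDoubleCategory CW0 CW1 CWsrc CWtgt CWunit CWcomp
    CWsrc_unit CWtgt_unit CWsrc_comp CWtgt_comp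
    CWcomp_unitl CWcomp_unitr CWcompA.

End CW.

(* Main.v *)
(* All the categories involved are thin, so only the existence of arrows
   matters.  By CF2 two objects of C{W} are joined by a vertical arrow exactly
   when they have the same codomain, whence the first condition.  For the
   second, a chain of horizontal arrows that match only up to vertical arrows
   is rectified from right to left: a further application of CF2 slides each
   horizontal arrow, along an invertible double cell, to one with any
   prescribed target in the same component. *)
From mathcomp Require Import all_boot.
From mathcomp Require Import boolp.
Require Import Defs.

Set Implicit Arguments.
Unset Strict Implicit.
Unset Printing Implicit Defensive.

Local Open Scope cat_scope.

(** Faithfulness, functor laws, naturality and inverse laws are equalities of parallel arrows, so
    thinness leaves only fullness and essential surjectivity. *)
Lemma thin_is_equivalence (A B : Category) (F : Functor A B) :
  thin A -> thin B ->
  (forall a a', Hom (F a) (F a') -> inhabited (Hom a a')) ->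
  (forall b, exists a, inhabited (Hom (F a) b) /\ inhabited (Hom b (F a))) ->
  is_equivalence F.
Proof.
move=> thA thB full /choice [G0 G0P].
have eps b : Hom (F (G0 b)) b := some_of (proj1 (G0P b)).
have eps' b : Hom b (F (G0 b)) := some_of (proj2 (G0P b)).
pose lift a a' (h : Hom (F a) (F a')) : Hom a a' := some_of (full a a' h).
pose G := @MkFunctor B A G0 (fun b b' h => lift _ _ (eps' b' ∘ h ∘ eps b))
  (fun=> thA _ _ _ _) (fun _ _ _ _ _ => thA _ _ _ _).
exists G; split.
- exists (fun a => lift (G0 (F a)) a (eps (F a))); split=> [a b h|a].
    exact: thA.
  by exists (lift a (G0 (F a)) (eps' (F a))); split; apply: thA.
- exists eps; split=> [a b h|b]; first exact: thB.
  by exists (eps' b); split; apply: thB.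
Qed.

Lemma Discrete_thin (T : Type) : thin (Discrete T).
Proof. by move=> a b; exact (@Prop_irrelevance (a = b)). Qed.

Lemma Chain_thin (A X : Category) (n : nat) (s t : Functor A X) :
  thin A -> thin (Chain n s t).
Proof.
move=> thA a b f g; apply: sig_eq.
by apply: functional_extensionality_dep => i; apply: thA.
Qed.

Lemma class_connectedP (X : Category) (x y : X) :
  class (@connected X) x = class (@connected X) y <-> connected x y.
Proof.
apply: class_eqP; [|exact: connected_sym|exact: connected_trans].
by move=> z; apply: connected_hom (idm z).
Qed.

Section Components.
Context (X : Category).

Definition component (x : X) : Discrete (components X) :=
  class (@connected X) x.

Lemma component_hom (x y : X) (h : Hom x y) : component x = component y.
Proof. by apply/class_connectedP/connected_hom. Qed.

Definition to_components : Functor X (Discrete (components X)) :=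
  @MkFunctor X (Discrete (components X)) component component_hom
    (fun=> Discrete_thin _ _) (fun _ _ _ _ _ => Discrete_thin _ _).

Lemma to_components_equivalence :
  thin X -> (forall x y : X, connected x y -> inhabited (Hom x y)) ->
  is_equivalence to_components.
Proof.
move=> thX conn; apply: thin_is_equivalence => // [|x y /class_connectedP|q].
- exact: Discrete_thin.
- exact: conn.
- exists (repr q); have e : component (repr q) = q := reprK q.
  by split; apply: inhabits; [exact: e|exact: esym].
Qed.

End Components.

(* The hypothesis [lift] says that [t] is an isofibration. *)
Lemma chain_map_equivalence (A X : Category) (T : Type) (n : nat)
    (s t : Functor A X) (gamma : Functor X (Discrete T)) :
  thin A -> thin X ->
  (forall x y, gamma x = gamma y -> inhabited (Hom x y)) ->
  (forall a x, Hom (t a) x -> exists a',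
     t a' = x /\ inhabited (Hom a a') /\ inhabited (Hom a' a)) ->
  is_equivalence (chain_map n.+1 s t gamma).
Proof.
move=> thA thX full lift.
apply: thin_is_equivalence => [||a b h|a].
- exact: Chain_thin.
- exact: Chain_thin.
- apply: inhabits; exists (sval h) => i j ij.
  by apply: arr_thin thX _ _;
    [exact: (svalP a _ _ ij)|exact: (svalP b _ _ ij)].
(* A total choice of lifts, so that the recursion below carries no proofs; [b] is a default value
   where there is no arrow to lift along. *)
have /choice [L LP] : forall p : A * X, exists a', inhabited (Hom (t p.1) p.2) ->
    t a' = p.2 /\ inhabited (Hom p.1 a') /\ inhabited (Hom a' p.1).
  move=> [b x] /=; have [[h]|no] := pselect (inhabited (Hom (t b) x)).
    by have [a' a'P] := lift b x h; exists a'.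
  by exists b => /no.
pose a_ k := sval a (inord k).
(* [B k] replaces the entry of index [n - k]: the last entry is kept, and each earlier one is lifted
   so as to end at the source of its rectified successor. *)
pose B := fix B k := if k is k'.+1 then L (a_ (n - k), s (B k')) else a_ n.
have a_S k : k < n -> gamma (t (a_ (n - k.+1))) = gamma (s (a_ (n - k))).
  move=> kn; apply: (svalP a); rewrite !inordK ?ltnS ?leq_subr //.
  by rewrite subnSK.
have BS k : k < n -> inhabited (Hom (a_ (n - k)) (B k)) ->
    t (B k.+1) = s (B k) /\ inhabited (Hom (a_ (n - k.+1)) (B k.+1)) /\
    inhabited (Hom (B k.+1) (a_ (n - k.+1))).
  move=> kn [h]; apply: (LP (_, _)); apply: full => /=.
  (* Arrows of a discrete category are equalities: the image of [h] equates the values of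
     [gamma ⊚ s] at [a_ (n - k)] and [B k]. *)
  by rewrite (a_S k kn); exact (fhom (gamma ⊚ s) h).
have BP k : k <= n -> inhabited (Hom (a_ (n - k)) (B k)) /\
                      inhabited (Hom (B k) (a_ (n - k))).
  elim: k => [_|k IH kn].
    by rewrite subn0; split; apply: inhabits; apply: idm.
  by have [_] := BS k kn (proj1 (IH (ltnW kn))).
have b_chain (i j : 'I_n.+1) : j = i.+1 :> nat -> t (B (n - i)) = s (B (n - j)).
  move=> ij; have jn : j <= n by rewrite -ltnS.
  have -> : n - i = (n - j).+1 by rewrite ij subnSK // -ij.
  (* Since [j = i + 1] is positive, [n - j] is a genuine step of the recursion. *)
  have nj : n - j < n by rewrite ij ltn_subrL -ij (leq_trans _ jn) // ij.
  by have [] := BS _ nj (proj1 (BP _ (ltnW nj))).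
pose b : Chain n.+1 s t := exist _ (fun i : 'I_n.+1 => B (n - i)) b_chain.
have bP (i : 'I_n.+1) : inhabited (Hom (sval a i) (B (n - i))) /\
                        inhabited (Hom (B (n - i)) (sval a i)).
  have i_n : i <= n by rewrite -ltnS.
  by have := BP (n - i) (leq_subr _ _); rewrite (subKn i_n) /a_ inord_val.
(* The comparison arrows are taken entry by entry; over the discrete base they match because their
   ends do. *)
exists b; split; apply: inhabits.
- exists (fun i => some_of (proj2 (bP i))) => i j ij.
  apply: arr_thin; first exact: Discrete_thin.
    exact: (svalP (chain_map n.+1 s t gamma b) _ _ ij).
  exact: (svalP a _ _ ij).
- exists (fun i => some_of (proj1 (bP i))) => i j ij.
  apply: arr_thin; first exact: Discrete_thin.
    exact: (svalP a _ _ ij).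
  exact: (svalP (chain_map n.+1 s t gamma b) _ _ ij).
Qed.

Section Fractions.
Context (C : Category) (W : ArrowClass C).
Context (cf1 : CF1 W) (cf2 : CF2 W) (cf3 : CF3 W).

(** CF2 for two arrows of [W]; recording that [u1] lies in [W] allows CF2 to be applied along it
    again. *)
Lemma span_W (A1 A2 B : C) (w1 : Hom A1 B) (w2 : Hom A2 B) : W w1 -> W w2 ->
  exists (D : C) (u1 : Hom D A1) (u2 : Hom D A2),
    [/\ w1 ∘ u1 = w2 ∘ u2, W u1 & W (w1 ∘ u1)].
Proof.
move=> W1 W2; have [D [u2 [u1 [Wu1 e]]]] := cf2 w1 W2.
by exists D, u1, u2; split=> //; apply: (proj2 cf1).
Qed.

Lemma vspan_cod (w1 w2 : WObj W) (u : VSpan w1 w2) : wcod w1 = wcod w2.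
Proof. by have [] := arr_ends (vsp_comm u). Qed.

Lemma CW0_connected (x y : CW0 cf1 cf2 cf3) :
  connected x y -> inhabited (Hom x y).
Proof.
(* The codomain is constant along zigzags of vertical arrows. *)
move=> xy; have {xy} : wcod x = wcod y.
  elim: xy => {x y} [x y h|x y _ ->|x y z _ -> _ ->] //.
  exact: vspan_cod (repr h).
case: x y => [A1 B1 w1 W1] [A2 B2 w2 W2] /= e; subst B2.
have [D [u1 [u2 [e _ Ww]]]] := span_W W1 W2; apply: inhabits.
exact: (varr (@MkVSpan _ _ (MkWObj W1) (MkWObj W2) D u1 u2 (congr1 _ e) Ww)).
Qed.

(** A span [u1], [u2] joins the old target to the new one. CF2 for [f] against [u1] gives
    [u1 ∘ g = f ∘ r], and [u2 ∘ g], with source [w ∘ r], is the lift. *)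
Lemma CWtgt_lift (f : CW1 cf1 cf2 cf3) (v : CW0 cf1 cf2 cf3) :
  Hom (CWtgt cf1 cf2 cf3 f) v -> exists f' : CW1 cf1 cf2 cf3,
    CWtgt cf1 cf2 cf3 f' = v /\ inhabited (Hom f f') /\ inhabited (Hom f' f).
Proof.
case: f => w [A1 B1 w1 W1] f h; have := vspan_cod (repr h).
case: v {h} => [A2 B2 w2 W2] /= e; subst B2.
have [D [u1 [u2 [e Wu1 Ww]]]] := span_W W1 W2.
have [E [g [r [Wr eg]]]] := cf2 f Wu1.
have Wwr : W (warr w ∘ r) by apply: (proj2 cf1) Wr; apply: warrP.
pose w' := MkWObj Wwr; pose v1 := MkWObj W1; pose v2 := MkWObj W2.
pose f' : Hom (wdom w') (wdom v2) := u2 ∘ g.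
have Ww2 : W (w2 ∘ u2) by rewrite -e.
have lc : warr w ∘ r = warr w' ∘ idm E by rewrite compose_idr.
have Wl : W (warr w' ∘ idm E) by rewrite -lc.
(* [l] and [k] are the sides of the cell from [f] to [f']; [l'] and [k'] are these spans reversed,
   and [g] represents the cells in both directions. *)
pose l := @MkVSpan _ _ w w' E r (idm E) (congr1 _ lc) Wwr.
pose l' := @MkVSpan _ _ w' w E (idm E) r (congr1 _ (esym lc)) Wl.
pose k := @MkVSpan _ _ v1 v2 D u1 u2 (congr1 _ e) Ww.
pose k' := @MkVSpan _ _ v2 v1 D u2 u1 (congr1 _ (esym e)) Ww2.
have top : f ∘ leg1 l = leg1 k ∘ g by rewrite /= eg.
have bot : f' ∘ leg2 l = leg2 k ∘ g by rewrite /= compose_idr.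
exists (MkHArr f'); split=> //; split; apply: inhabits.
- exact: (@MkDCell _ _ (@MkHArr _ _ w v1 f) (MkHArr f') _ _
    (cell (MkCellRep (lrep := l) (rrep := k) erefl erefl g top bot))).
- exact: (@MkDCell _ _ (MkHArr f') (@MkHArr _ _ w v1 f) _ _
    (cell (MkCellRep (lrep := l') (rrep := k') erefl erefl g bot top))).
Qed.

End Fractions.

Theorem theorem5p7 (C : Category) (W : ArrowClass C)
  (cf1 : CF1 W) (cf2 : CF2 W) (cf3 : CF3 W) :
  weakly_globular (CW cf1 cf2 cf3).
Proof.
exists (to_components (CW0 cf1 cf2 cf3)); split.
  by apply: to_components_equivalence; [exact: CW0_thin|exact: CW0_connected].
case=> [//|n] _; apply: chain_map_equivalence.
- exact: CW1_thin.
- exact: CW0_thin.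
(* Objects with the same component are connected, hence joined by a single vertical arrow. *)
- by move=> x y /class_connectedP; apply: CW0_connected.
- exact: CWtgt_lift.
Qed.
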